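(* Each endomorphism of a term of the series $I=I(0)\supset I(1)\supset I(2)\supset\cdots$ of $RG$-modules or of the series $L=L(0)\supseteq L(1)\supseteq L(2)\supseteq\cdots$ of $KG$-modules is a scalar. That is, for every $c\ge 0$, every $RG$-endomorphism of $I(c)$ is multiplication by an element of $R$, and every $KG$-endomorphism of $L(c)$ is multiplication by an element of $K$.
   Context: Let $n\ge 2$ and $G=\mathrm{GL}_n(q)$, the general linear group over the finite field $F_q$ of characteristic $p$. Let $\ell\ne p$ be a prime, and let $R$ be a local principal ideal domain of characteristic $0$ with maximal ideal $\ell R$, containing a primitive $p$-th root of unity; $K=R/\ell R$. Modules are left modules. $B$ is the group of upper triangular matrices in $G$; $S_n$ is viewed as the subgroup of permutation matrices of $G$; $\widehat{S}=\sum_{s\in S}s\in RG$ for $S\subseteq G$. Put $\varepsilon=\sum_{\sigma\in S_n}\mathrm{sg}(\sigma)\,\sigma\widehat{B}\in RG$. The Steinberg lattice is the left ideal $I=RG\cdot\varepsilon$, and $L=I/\ell I$, a $KG$-module. Let $f:I\times I\to R$ be the restriction to $I$ of the $R$-bilinear form on $RG$ given by $(g,h)\mapsto\delta_{g,h}$ for $g,h\in G$, scaled by $1/|B|$ (it takes values in $R$). For $c\ge 0$ put $I(c)=\{x\in I : f(x,I)\subseteq \ell^cR\}$ and $L(c)=(I(c)+\ell I)/\ell I$. *)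

(* Defs.v *)
From HB Require Import structures.
From mathcomp Require Import all_boot all_order all_fingroup all_algebra.
From mathcomp Require Import boolp.

Set Implicit Arguments.
Unset Strict Implicit.
Unset Printing Implicit Defensive.

Import GRing.Theory.
Local Open Scope ring_scope.
Local Open Scope quotient_scope.

Definition principal_ideal_ring (R : comNzRingType) : Prop :=
  forall J : {pred R^o}, submod_closed J ->
    exists a : R, forall x : R, (x \in J) <-> (exists b : R, x = b * a).

Definition maximal_ideal (R : comNzRingType) (M : {pred R}) : Prop :=
  idealr_closed M /\
  forall J : {pred R}, idealr_closed J -> {subset M <= J} -> J =i M.

Definition local_with_maximal_ideal (R : comNzRingType) (M : {pred R}) : Prop :=
  maximal_ideal M /\ forall J : {pred R}, maximal_ideal J -> J =i M.

Section GroupAlgebra.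
Variables (R : comPzRingType) (gT : finGroupType).

(* R[gT] as functions gT -> R, multiplied by convolution. *)
Definition group_algebra : Type := {ffun gT -> R}.
Local Notation RG := group_algebra.

HB.instance Definition _ := GRing.Lmodule.copy RG {ffun gT -> R^o}.

Definition ga_coef (x : RG) (g : gT) : R := (x : {ffun gT -> R}) g.

Definition ga_of (c : gT -> R) : RG := [ffun g => c g].

Definition ga_elt (g : gT) : RG := ga_of (fun h => (h == g)%:R).

Definition ga_hat (S : {set gT}) : RG := \sum_(s in S) ga_elt s.

Definition ga_mul (x y : RG) : RG :=
  ga_of (fun g => \sum_h ga_coef x h * ga_coef y (h^-1 * g)%g).

Lemma ga_ofE c g : ga_coef (ga_of c) g = c g.
Proof. by rewrite /ga_coef /ga_of ffunE. Qed.

Lemma gaP (x y : RG) : ga_coef x =1 ga_coef y -> x = y.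
Proof. by move=> exy; apply/ffunP. Qed.

Lemma ga_coefD (x y : RG) g : ga_coef (x + y) g = ga_coef x g + ga_coef y g.
Proof. by rewrite /ga_coef ffunE. Qed.

Lemma ga_coefZ (a : R) (x : RG) g : ga_coef (a *: x) g = a * ga_coef x g.
Proof. by rewrite /ga_coef ffunE. Qed.

Lemma ga_mulA : associative ga_mul.
Proof.
move=> x y z; apply: gaP => g; rewrite !ga_ofE.
under eq_bigr do rewrite ga_ofE mulr_sumr.
under [RHS]eq_bigr do rewrite ga_ofE mulr_suml.
rewrite [RHS]exchange_big /=; apply: eq_bigr => h _.
rewrite [RHS](reindex_inj (mulgI h)) /=; apply: eq_bigr => k _.
by rewrite mulKg mulrA invMg mulgA.
Qed.

Lemma ga_mul1l : left_id (ga_elt 1%g) ga_mul.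
Proof.
move=> x; apply: gaP => g; rewrite ga_ofE (bigD1 1%g) //= ga_ofE eqxx mul1r.
rewrite invg1 mul1g big1 ?addr0 // => h /negPf h1.
by rewrite ga_ofE h1 mul0r.
Qed.

Lemma ga_mul1r : right_id (ga_elt 1%g) ga_mul.
Proof.
move=> x; apply: gaP => g; rewrite ga_ofE (bigD1 g) //= ga_ofE mulVg eqxx mulr1.
rewrite big1 ?addr0 // => h hg.
by rewrite ga_ofE -eq_mulVg1 (negPf hg) mulr0.
Qed.

Lemma ga_mulDl : left_distributive ga_mul +%R.
Proof.
move=> x y z; apply: gaP => g; rewrite ga_coefD !ga_ofE -big_split /=.
by apply: eq_bigr => h _; rewrite ga_coefD mulrDl.
Qed.

Lemma ga_mulDr : right_distributive ga_mul +%R.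
Proof.
move=> x y z; apply: gaP => g; rewrite ga_coefD !ga_ofE -big_split /=.
by apply: eq_bigr => h _; rewrite ga_coefD mulrDr.
Qed.

HB.instance Definition _ := GRing.Zmodule_isPzRing.Build RG
  ga_mulA ga_mul1l ga_mul1r ga_mulDl ga_mulDr.

Lemma ga_mulE (x y : RG) g :
  ga_coef (x * y) g = \sum_h ga_coef x h * ga_coef y (h^-1 * g)%g.
Proof. exact: ga_ofE. Qed.

Lemma ga_eltE g h : ga_coef (ga_elt g) h = (h == g)%:R.
Proof. exact: ga_ofE. Qed.

Lemma ga_mul_elt (x : RG) g h :
  ga_coef (x * ga_elt g) h = ga_coef x (h * g^-1)%g.
Proof.
rewrite ga_mulE (bigD1 (h * g^-1)%g) //= ga_eltE invMg invgK mulgKV eqxx mulr1.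
rewrite big1 ?addr0 // => k khg; rewrite ga_eltE.
case: eqP => [E|_]; last by rewrite mulr0.
by case/eqP: khg; rewrite -E invMg invgK mulKVg.
Qed.

Lemma ga_eltM g h : ga_elt (g * h)%g = ga_elt g * ga_elt h.
Proof.
by apply: gaP => k; rewrite ga_mul_elt !ga_eltE (can2_eq (mulgKV h) (mulgK h)).
Qed.

Lemma ga_hat_elt (S : {group gT}) g : g \in S -> ga_hat S * ga_elt g = ga_hat S.
Proof.
move=> gS; rewrite /ga_hat mulr_suml [RHS](reindex_inj (mulIg g)) /=.
by apply: eq_big => h; rewrite ?groupMr // ga_eltM.
Qed.

Lemma ga_scaleAl (a : R) (x y : RG) : a *: (x * y) = a *: x * y.
Proof.
apply: gaP => g; rewrite ga_coefZ !ga_ofE mulr_sumr.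
by apply: eq_bigr => h _; rewrite ga_coefZ mulrA.
Qed.

Lemma ga_scaleAr (a : R) (x y : RG) : a *: (x * y) = x * (a *: y).
Proof.
apply: gaP => g; rewrite ga_coefZ !ga_ofE mulr_sumr.
by apply: eq_bigr => h _; rewrite ga_coefZ mulrCA.
Qed.

Definition ga_scalar (a : R) : RG := a *: (1 : RG).

Lemma ga_scalarE (a : R) (x : RG) : ga_scalar a * x = a *: x.
Proof. by rewrite -ga_scaleAl mul1r. Qed.

(* The bilinear form with (g, h) |-> delta_{g,h}; see ga_form_elt. *)
Definition ga_form (x y : RG) : R := \sum_g ga_coef x g * ga_coef y g.

Lemma ga_form_elt (g h : gT) : ga_form (ga_elt g) (ga_elt h) = (g == h)%:R.
Proof.
rewrite /ga_form (bigD1 g) //= !ga_ofE eqxx mul1r big1 ?addr0 // => k /negPf kg.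
by rewrite ga_ofE kg mul0r.
Qed.

Lemma ga_form_linearl (a : R) (x y z : RG) :
  ga_form (a *: x + y) z = a * ga_form x z + ga_form y z.
Proof.
rewrite /ga_form mulr_sumr -big_split /=; apply: eq_bigr => g _.
by rewrite ga_coefD ga_coefZ mulrDl mulrA.
Qed.

Lemma ga_form_linearr (a : R) (x y z : RG) :
  ga_form z (a *: x + y) = a * ga_form z x + ga_form z y.
Proof.
rewrite /ga_form mulr_sumr -big_split /=; apply: eq_bigr => g _.
by rewrite ga_coefD ga_coefZ mulrDr mulrCA.
Qed.

(* The linear extension of g |-> g^-1. *)
Definition ga_adj (a : RG) : RG := ga_of (fun g => ga_coef a g^-1%g).

Lemma ga_form_adj (a x y : RG) : ga_form (a * x) y = ga_form x (ga_adj a * y).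
Proof.
rewrite /ga_form; under eq_bigr do rewrite ga_ofE mulr_suml.
under [RHS]eq_bigr do rewrite ga_ofE mulr_sumr.
rewrite exchange_big [RHS]exchange_big /= [RHS](reindex_inj invg_inj) /=.
apply: eq_bigr => h _; rewrite (reindex_inj (mulgI h)) /=.
by apply: eq_bigr => g _; rewrite mulKg ga_ofE !invgK mulrA [X in _ = X * _]mulrC.
Qed.

End GroupAlgebra.

Section Submodule.
Variables (A : pzRingType) (V : lmodType A) (S : submodClosed V).

Record submodule : Type :=
  Submodule { submodule_val :> V; submodule_valP : submodule_val \in S }.

HB.instance Definition _ := [isSub for submodule_val].
HB.instance Definition _ := [Choice of submodule by <:].
HB.instance Definition _ := [SubChoice_isSubLmodule of submodule by <:].

End Submodule.

Section Residue.
Variables (R : comNzRingType) (l : nat).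

Definition multiples : {pred R} := fun x => `[< exists y : R, x = l%:R * y >].

Lemma multiplesP (x : R) :
  reflect (exists y : R, x = l%:R * y) (x \in multiples).
Proof. exact: asboolP. Qed.

Lemma multiples_zmod_closed : zmod_closed multiples.
Proof.
split=> [|_ _ /multiplesP[x ->] /multiplesP[y ->]]; apply/multiplesP.
  by exists 0; rewrite mulr0.
by exists (x - y); rewrite mulrBr.
Qed.

HB.instance Definition _ := GRing.isZmodClosed.Build R multiples
  multiples_zmod_closed.

Definition residue : Type := {ideal_quot multiples}.
Local Notation K := residue.

HB.instance Definition _ := GRing.Zmodule.on K.

Definition to_residue (x : R) : K := \pi_({ideal_quot multiples}) x.
Definition of_residue (u : K) : R := generic_quotient.repr (u : {ideal_quot multiples}).

Lemma of_residueK : cancel of_residue to_residue.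
Proof. by move=> u; rewrite /to_residue reprK. Qed.

Lemma to_residue_eq (x y : R) :
  (to_residue x = to_residue y) <-> (exists z, x - y = l%:R * z).
Proof.
by split=> [/eqP|xy]; [rewrite -Quotient.idealrBE => /multiplesP|
  apply/eqP; rewrite -Quotient.idealrBE; apply/multiplesP].
Qed.

Lemma to_residueD (x y : R) : to_residue (x + y) = to_residue x + to_residue y.
Proof. by rewrite /to_residue raddfD. Qed.

Definition residue_mul (u v : K) : K := to_residue (of_residue u * of_residue v).

Lemma residue_mulE (x y : R) :
  residue_mul (to_residue x) (to_residue y) = to_residue (x * y).
Proof.
apply/to_residue_eq.
have /to_residue_eq[a Ea] := of_residueK (to_residue x).
have /to_residue_eq[b Eb] := of_residueK (to_residue y).
exists (a * of_residue (to_residue y) + x * b).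
rewrite mulrDr mulrA -Ea mulrCA -Eb mulrBl mulrBr.
by rewrite addrA subrK.
Qed.

Lemma residue_mulA : associative residue_mul.
Proof.
move=> u v w; rewrite -(of_residueK u) -(of_residueK v) -(of_residueK w).
by rewrite !residue_mulE mulrA.
Qed.

Lemma residue_mulC : commutative residue_mul.
Proof.
by move=> u v; rewrite -(of_residueK u) -(of_residueK v) !residue_mulE mulrC.
Qed.

Lemma residue_mul1 : left_id (to_residue 1) residue_mul.
Proof. by move=> u; rewrite -(of_residueK u) residue_mulE mul1r. Qed.

Lemma residue_mulDl : left_distributive residue_mul +%R.
Proof.
move=> u v w; rewrite -(of_residueK u) -(of_residueK v) -(of_residueK w).
by rewrite -to_residueD !residue_mulE mulrDl to_residueD.
Qed.

HB.instance Definition _ := GRing.Zmodule_isComPzRing.Build K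
  residue_mulA residue_mulC residue_mul1 residue_mulDl.

Lemma to_residue_zmod_morphism : zmod_morphism to_residue.
Proof. by move=> x y; rewrite /to_residue raddfB. Qed.

Lemma to_residue_monoid_morphism : monoid_morphism to_residue.
Proof. by split=> // x y; rewrite -residue_mulE. Qed.

HB.instance Definition _ :=
  GRing.isZmodMorphism.Build R K to_residue to_residue_zmod_morphism.
HB.instance Definition _ :=
  GRing.isMonoidMorphism.Build R K to_residue to_residue_monoid_morphism.

End Residue.

Arguments multiples R l : clear implicits.

Section Reduction.
Variables (R : comNzRingType) (gT : finGroupType) (l : nat).
Local Notation RG := (group_algebra R gT).
Local Notation K := (residue R l).
Local Notation KG := (group_algebra K gT).
Variable V : lmodType RG.

Definition mod_multiples : {pred V} := fun x => `[< exists y : V, x = y *+ l >].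

Lemma mod_multiplesP (x : V) :
  reflect (exists y : V, x = y *+ l) (x \in mod_multiples).
Proof. exact: asboolP. Qed.

Lemma mod_multiples_zmod_closed : zmod_closed mod_multiples.
Proof.
split=> [|_ _ /mod_multiplesP[x ->] /mod_multiplesP[y ->]].
  by apply/mod_multiplesP; exists 0; rewrite mul0rn.
by apply/mod_multiplesP; exists (x - y); rewrite mulrnBl.
Qed.

HB.instance Definition _ := GRing.isZmodClosed.Build V mod_multiples
  mod_multiples_zmod_closed.

Definition reduction : Type := {ideal_quot mod_multiples}.
Local Notation L := reduction.

HB.instance Definition _ := GRing.Zmodule.on L.

Definition to_reduction (x : V) : L := \pi_({ideal_quot mod_multiples}) x.
Definition of_reduction (v : L) : V := generic_quotient.repr (v : {ideal_quot mod_multiples}).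

Lemma of_reductionK : cancel of_reduction to_reduction.
Proof. by move=> v; rewrite /to_reduction reprK. Qed.

Lemma to_reduction_eq (x y : V) :
  (to_reduction x = to_reduction y) <-> (exists z, x - y = z *+ l).
Proof.
by split=> [/eqP|xy]; [rewrite -Quotient.idealrBE => /mod_multiplesP|
  apply/eqP; rewrite -Quotient.idealrBE; apply/mod_multiplesP].
Qed.

Lemma to_reduction_zmod_morphism : zmod_morphism to_reduction.
Proof. by move=> x y; rewrite /to_reduction raddfB. Qed.

HB.instance Definition _ :=
  GRing.isZmodMorphism.Build V L to_reduction to_reduction_zmod_morphism.

Definition ga_reduce (a : RG) : KG :=
  ga_of (fun g => to_residue l (ga_coef a g)).
Definition ga_lift (u : KG) : RG := ga_of (fun g => of_residue (ga_coef u g)).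

Lemma ga_reduceE (a : RG) g :
  ga_coef (ga_reduce a) g = to_residue l (ga_coef a g).
Proof. exact: ga_ofE. Qed.

Lemma ga_liftK : cancel ga_lift ga_reduce.
Proof. by move=> u; apply: gaP => g; rewrite !ga_ofE of_residueK. Qed.

Lemma ga_reduce_eq (a b : RG) :
  ga_reduce a = ga_reduce b -> exists d : RG, a - b = d *+ l.
Proof.
move=> eab.
have dP g : exists d : R, ga_coef a g - ga_coef b g == l%:R * d.
  have := congr1 (fun u => ga_coef u g) eab.
  by rewrite !ga_ofE => /to_residue_eq[d /eqP]; exists d.
exists (ga_of (fun g => xchoose (dP g))); apply/eqP; rewrite subr_eq; apply/eqP.
apply: gaP => g; rewrite ga_coefD -scaler_nat ga_coefZ ga_ofE.
by rewrite -(eqP (xchooseP (dP g))) subrK.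
Qed.

Lemma ga_reduce_add (a b : RG) :
  ga_reduce (a + b) = ga_reduce a + ga_reduce b.
Proof.
by apply: gaP => g; rewrite ga_coefD !ga_reduceE ga_coefD rmorphD.
Qed.

Lemma ga_reduce_mul (a b : RG) :
  ga_reduce (a * b) = ga_reduce a * ga_reduce b.
Proof.
apply: gaP => g; rewrite !ga_ofE rmorph_sum.
by apply: eq_bigr => h _; rewrite !ga_ofE rmorphM.
Qed.

Lemma ga_reduce1 : ga_reduce 1 = 1.
Proof. by apply: gaP => g; rewrite !ga_ofE rmorph_nat. Qed.

(* Representatives are used only to define the action; reduction_scaleE shows
   that it is the one induced by the action of RG on V. *)
Definition reduction_scale (u : KG) (v : L) : L :=
  to_reduction (ga_lift u *: of_reduction v).

Lemma reduction_scaleE (a : RG) (x : V) :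
  reduction_scale (ga_reduce a) (to_reduction x) = to_reduction (a *: x).
Proof.
apply/to_reduction_eq.
have /to_reduction_eq[y Ey] := of_reductionK (to_reduction x).
have [d Ed] := ga_reduce_eq (ga_liftK (ga_reduce a)).
exists (d *: of_reduction (to_reduction x) + a *: y).
rewrite mulrnDl scalerMnl -Ed scalerMnr -Ey.
by rewrite scalerBl scalerBr addrA subrK.
Qed.

Lemma reduction_scaleA (a b : KG) (v : L) :
  reduction_scale a (reduction_scale b v) = reduction_scale (a * b) v.
Proof.
rewrite -(ga_liftK a) -(ga_liftK b) -(of_reductionK v).
by rewrite -ga_reduce_mul !reduction_scaleE scalerA.
Qed.

Lemma reduction_scale1 : left_id 1 reduction_scale.
Proof.
by move=> v; rewrite -(of_reductionK v) -ga_reduce1 reduction_scaleE scale1r.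
Qed.

Lemma reduction_scaleDr : right_distributive reduction_scale +%R.
Proof.
move=> a v w; rewrite -(ga_liftK a) -(of_reductionK v) -(of_reductionK w).
by rewrite -raddfD !reduction_scaleE scalerDr raddfD.
Qed.

Lemma reduction_scaleDl (v : L) :
  {morph reduction_scale^~ v : a b / a + b}.
Proof.
move=> a b; rewrite -(ga_liftK a) -(ga_liftK b) -(of_reductionK v).
by rewrite -ga_reduce_add !reduction_scaleE scalerDl raddfD.
Qed.

HB.instance Definition _ := GRing.Zmodule_isLmodule.Build KG L
  reduction_scaleA reduction_scale1 reduction_scaleDr reduction_scaleDl.

End Reduction.

Arguments mod_multiples {R gT} l V.

Section Steinberg.
Variables (F : finFieldType) (n : nat) (R : idomainType) (l : nat).
Local Notation G := {'GL_n[F]}.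
Local Notation RG := (group_algebra R G).
Local Notation K := (residue R l).
Local Notation KG := (group_algebra K G).

(* {'GL_n[F]} consists of matrices of size n.-1.+1, which is n when 0 < n. *)
Definition borel : {set G} :=
  [set g : G | [forall i : 'I_n.-1.+1, forall j : 'I_n.-1.+1,
     (j < i)%N ==> (GLval g i j == 0)]].

Lemma borelP (g : G) :
  reflect (forall i j : 'I_n.-1.+1, (j < i)%N -> GLval g i j = 0)
          (g \in borel).
Proof.
rewrite inE; apply: (iffP forallP) => H i => [j ji|].
  by have /forallP/(_ j)/implyP/(_ ji)/eqP := H i.
by apply/forallP => j; apply/implyP => /H/eqP.
Qed.

Lemma borel_group_set : group_set borel.
Proof.
apply/group_setP; split=> [|g h /borelP gB /borelP hB].
  by apply/borelP => i j ji; rewrite GL_1E mxE -val_eqE /= gtn_eqF.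
apply/borelP => i j ji; rewrite GL_MxE mxE big1 // => k _.
have [ki|ik] := ltnP k i; first by rewrite gB // mul0r.
by rewrite hB ?mulr0 // (leq_trans ji).
Qed.

Canonical borel_group := Group borel_group_set.

Definition perm_GL (s : 'S_n.-1.+1) : G := FinRing.Unit (unitmx_perm F s).

Definition steinberg_gen : RG :=
  \sum_(s : 'S_n.-1.+1) (-1) ^+ s *: (ga_elt R (perm_GL s) * ga_hat R borel).

Definition steinberg_pred : {pred RG^o} :=
  fun x => `[< exists a : RG, x = a * steinberg_gen >].

Lemma steinberg_predP (x : RG) :
  reflect (exists a : RG, x = a * steinberg_gen) ((x : RG^o) \in steinberg_pred).
Proof. exact: asboolP. Qed.

Lemma steinberg_submod_closed : submod_closed steinberg_pred.
Proof.
split=> [|b _ _ /steinberg_predP[x ->] /steinberg_predP[y ->]].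
  by apply/steinberg_predP; exists 0; rewrite mul0r.
by apply/steinberg_predP; exists (b * x + y); rewrite mulrDl -mulrA.
Qed.

HB.instance Definition _ := GRing.isSubmodClosed.Build RG RG^o steinberg_pred
  steinberg_submod_closed.

Definition steinberg : lmodType RG := submodule steinberg_pred.

(* The scaling by 1/|B| takes place in the fraction field of R;
   steinberg_form_int shows that the values lie in R. *)
Definition steinberg_form (x y : steinberg) : {fraction R} :=
  tofrac (ga_form (val x) (val y)) / #|borel|%:R.

Lemma steinberg_formD (x y z : steinberg) :
  steinberg_form (x + y) z = steinberg_form x z + steinberg_form y z.
Proof.
rewrite /steinberg_form -mulrDl -rmorphD /=; congr (tofrac _ / _).
have := ga_form_linearl 1 (val x : RG) (val y : RG) (val z : RG).
by rewrite scale1r mul1r => <-.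
Qed.

Lemma steinberg_formZ (a : RG) (x y : steinberg) :
  steinberg_form (a *: x) y = steinberg_form x (ga_adj a *: y).
Proof. by rewrite /steinberg_form ga_form_adj. Qed.

Lemma steinberg_coef (x : steinberg) (g b : G) :
  b \in borel -> ga_coef (val x) (g * b)%g = ga_coef (val x) g.
Proof.
move=> bB; have /steinberg_predP[a Ea] := valP x; rewrite /= in Ea *.
suff genb : steinberg_gen * ga_elt R b^-1%g = steinberg_gen.
  by rewrite Ea -{1}[b]invgK -ga_mul_elt -mulrA genb.
rewrite /steinberg_gen mulr_suml; apply: eq_bigr => s _.
by rewrite -ga_scaleAl -mulrA ga_hat_elt ?groupV.
Qed.

Lemma steinberg_form_int (x y : steinberg) :
  #|borel|%:R != 0 :> R -> exists r : R, steinberg_form x y = tofrac r.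
Proof.
move=> B0; pose E g := ga_coef (val x) g * ga_coef (val y) g.
suff [r Er] : exists r, ga_form (val x) (val y) = #|borel|%:R * r.
  exists r; rewrite /steinberg_form Er rmorphM /= rmorph_nat mulrC mulKf //.
  by rewrite -(rmorph_nat (@tofrac R)) tofrac_eq0.
pose r C := if [pick g | (g *: borel)%g == C] is Some g then E g else 0.
exists (\sum_C r C); rewrite mulr_sumr.
rewrite /ga_form (partition_big (fun g => (g *: borel)%g) xpredT) //=.
apply: eq_bigr => C _; rewrite /r; case: pickP => [g /eqP <-|noC]; last first.
  by rewrite mulr0 big_pred0.
rewrite (eq_bigr (fun _ => E g)) => [|h /eqP hg]; last first.
  have : h \in (h *: borel)%g by rewrite lcoset_refl.
  rewrite hg => /lcosetP[b bB ->].
  by rewrite /E !steinberg_coef.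
rewrite sumr_const mulr_natl -(card_lcoset _ g); congr (_ *+ _).
apply: eq_card => h; transitivity ((h *: borel)%g == (g *: borel)%g) => //.
apply/eqP/idP => [hg|/lcoset_eqP //].
by have := lcoset_refl [the {group _} of borel] h; rewrite hg.
Qed.

Definition steinberg_term_pred (c : nat) : {pred steinberg} :=
  fun x => `[< forall y : steinberg,
    exists r : R, steinberg_form x y = tofrac (l%:R ^+ c * r) >].

Lemma steinberg_term_predP (c : nat) (x : steinberg) :
  reflect (forall y, exists r : R, steinberg_form x y = tofrac (l%:R ^+ c * r))
          (x \in steinberg_term_pred c).
Proof. exact: asboolP. Qed.

Lemma steinberg_term0 (x : steinberg) :
  #|borel|%:R != 0 :> R -> x \in steinberg_term_pred 0.
Proof.
move=> B0; apply/steinberg_term_predP => y.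
by have [r ->] := steinberg_form_int x y B0; exists r; rewrite mul1r.
Qed.

Lemma steinberg_term_submod_closed (c : nat) :
  submod_closed (steinberg_term_pred c).
Proof.
split=> [|a x y /steinberg_term_predP Hx /steinberg_term_predP Hy];
  apply/steinberg_term_predP => z.
  exists 0; rewrite mulr0 rmorph0 /steinberg_form /ga_form big1.
    by rewrite rmorph0 mul0r.
  by move=> g _; rewrite /ga_coef ffunE mul0r.
have [r Er] := Hx (ga_adj a *: z); have [s Es] := Hy z.
exists (r + s).
by rewrite steinberg_formD steinberg_formZ Er Es -rmorphD mulrDr.
Qed.

HB.instance Definition _ (c : nat) :=
  GRing.isSubmodClosed.Build RG steinberg (steinberg_term_pred c)
    (steinberg_term_submod_closed c).

Definition steinberg_term (c : nat) : lmodType RG :=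
  submodule (steinberg_term_pred c).

Definition steinberg_mod : lmodType KG := reduction l steinberg.

Definition steinberg_mod_term_pred (c : nat) : {pred steinberg_mod} :=
  fun v => `[< exists x y : steinberg,
    [/\ x \in steinberg_term_pred c, y \in mod_multiples l steinberg
       & v = to_reduction l (x + y)] >].

(* This equals the image of I(c) in L = I / lI. *)
Lemma steinberg_mod_term_predP (c : nat) (v : steinberg_mod) :
  reflect (exists2 x : steinberg,
             x \in steinberg_term_pred c & v = to_reduction l x)
          (v \in steinberg_mod_term_pred c).
Proof.
apply: (iffP (asboolP _)) => [[x [y [xI /mod_multiplesP[z ->] ->]]]|[x xI ->]].
  by exists x => //; apply/to_reduction_eq; exists z; rewrite addrC addKr.
by exists x, 0; rewrite rpred0 addr0.
Qed.

Lemma steinberg_mod_term0 (v : steinberg_mod) :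
  #|borel|%:R != 0 :> R -> v \in steinberg_mod_term_pred 0.
Proof.
move=> B0; apply/steinberg_mod_term_predP; exists (of_reduction v).
  exact: steinberg_term0.
by rewrite of_reductionK.
Qed.

Lemma steinberg_mod_term_submod_closed (c : nat) :
  submod_closed (steinberg_mod_term_pred c).
Proof.
split=> [|a _ _ /steinberg_mod_term_predP[x xI ->]
             /steinberg_mod_term_predP[y yI ->]];
  apply/steinberg_mod_term_predP.
  by exists 0; rewrite ?rpred0 ?raddf0.
exists (ga_lift a *: x + y); first by rewrite rpredD ?rpredZ.
by rewrite raddfD /= -reduction_scaleE ga_liftK.
Qed.

HB.instance Definition _ (c : nat) :=
  GRing.isSubmodClosed.Build KG steinberg_mod (steinberg_mod_term_pred c)
    (steinberg_mod_term_submod_closed c).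

Definition steinberg_mod_term (c : nat) : lmodType KG :=
  submodule (steinberg_mod_term_pred c).

End Steinberg.

(* Main.v *)
Require Import Defs.
From HB Require Import structures.
From mathcomp Require Import all_boot all_order all_fingroup all_algebra.
From mathcomp Require Import zify.

Set Implicit Arguments.
Unset Strict Implicit.
Unset Printing Implicit Defensive.

Import GRing.Theory.
Local Open Scope ring_scope.

(** Write eps for the generator of the Steinberg lattice I, U for the upper
    unitriangular group, w0 for the longest permutation and v = U^ eps, where
    U^ is the sum of the elements of U.

    The theorem holds because the element t = sg(w0) U^ w0^-1 of RG acts on I
    as a projection of rank one: t x = c(x) v for all x in I, where
    c(x) = sg(w0) * (coefficient of x at w0), and t v = v. Moreover the kernel
    of t contains no nonzero G-submodule of I, since every x in I is recovered
    from the values c(g x): it is the sum over u in U of c(u^-1 x) u eps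
    (steinberg_expansion). This formula also shows that x lies in l I as soon
    as l divides all the c(g x), so the reductions of t and v behave in the
    same way on L = I / l I (steinberg_reduction_faithful).

    Such a t forces every endomorphism phi of a submodule X to be scalar
    (scalar_linear_endo). The scalars a with a v in X form an ideal, and it is
    principal, say with generator d. Then phi (d v) = phi (t d v) =
    t (phi (d v)) is a multiple of v that lies in X, so it is k d v for some k,
    and phi is multiplication by k on all the multiples of v in X. For x in X
    and g in G, the vector t g x is one of these multiples, so t g (phi x) =
    phi (t g x) = k t g x = t g (k x) for all g, and phi x = k x.

    The properties of t rest on two facts. The first is that the u eps with u
    in U span I (unitriangular_span_elt). Seen inside the permutation module on
    flags, g eps is the alternating sum of the flags of the frame formed by the
    columns of g, and these sums satisfy a three-term relation whenever one
    replaces two vectors of the frame by two others of the plane that they span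
    (steinberg_gen_three_term); with it, column elimination turns any g into
    upper triangular matrices, and the diagonal matrices fix eps. The second
    fact gives the coefficients of eps at u and at u w0 for u in U: they are 1,
    and sg(w0) or 0 according to whether u = 1 or not
    (ga_coef_steinberg_gen, unitriangular_longest). *)

(** The finite group structure of GL_n(F). Elements and products are typed
    through it, so that they match those of the group algebra syntactically. *)
Local Notation GLgroup F n :=
  (matrix.matrix_GLtype__canonical__fingroup_FinGroup n F).

(** * Group algebras *)

Section GroupAlgebraCoefficients.
Variables (A : comPzRingType) (gT : finGroupType).
Local Notation AG := (group_algebra A gT).

Lemma ga_coef_sum (I : Type) (r : seq I) (P : pred I) (f : I -> AG) g :
  ga_coef (\sum_(i <- r | P i) f i) g = \sum_(i <- r | P i) ga_coef (f i) g.
Proof.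
rewrite (big_morph (fun x : AG => ga_coef x g) (id1 := 0) (op1 := +%R)) //.
  by move=> x y; apply: ga_coefD.
by rewrite /ga_coef ffunE.
Qed.

Lemma ga_sum_elt (x : AG) : x = \sum_g ga_coef x g *: ga_elt A g.
Proof.
apply: gaP => h; rewrite ga_coef_sum (bigD1 h) //= ga_coefZ ga_eltE eqxx mulr1.
rewrite big1 ?addr0 // => g /negPf gh.
by rewrite ga_coefZ ga_eltE eq_sym gh mulr0.
Qed.

Lemma ga_coef_eltM (x : AG) g h :
  ga_coef (ga_elt A g * x) h = ga_coef x (g^-1 * h)%g.
Proof.
rewrite ga_mulE (bigD1 g) //= ga_eltE eqxx mul1r big1 ?addr0 // => k /negPf kg.
by rewrite ga_eltE kg mul0r.
Qed.

Lemma ga_coef_hat (S : {set gT}) g : ga_coef (ga_hat A S) g = (g \in S)%:R.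
Proof.
rewrite /ga_hat ga_coef_sum; under eq_bigr do rewrite ga_eltE eq_sym.
case: (boolP (g \in S)) => gS; last first.
  by rewrite big1 // => h hS; case: eqP gS => // <-; rewrite hS.
rewrite (bigD1 g) //= eqxx big1 ?addr0 // => h /andP[_ /negPf->].
by [].
Qed.

Lemma ga_elt_hat (H : {group gT}) g :
  g \in H -> ga_elt A g * ga_hat A H = ga_hat A H.
Proof.
move=> gH; apply: gaP => h.
by rewrite ga_coef_eltM !ga_coef_hat groupMl ?groupV.
Qed.

Lemma ga_elt_coset (H : {group gT}) g h : (g^-1 * h)%g \in H ->
  ga_elt A g * ga_hat A H = ga_elt A h * ga_hat A H.
Proof.
by move=> ghH; rewrite -[h](mulKVg g) ga_eltM -mulrA (ga_elt_hat ghH).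
Qed.

Lemma ga_scalarC (a : A) (x : AG) : x * ga_scalar gT a = ga_scalar gT a * x.
Proof. by rewrite ga_scalarE /ga_scalar -ga_scaleAr mulr1. Qed.

Lemma ga_scalarM (a b : A) :
  ga_scalar gT (a * b) = ga_scalar gT a * ga_scalar gT b.
Proof. by rewrite ga_scalarE /ga_scalar scalerA. Qed.

End GroupAlgebraCoefficients.

(** * Endomorphisms of a module with a rank one projection *)

Section ScalarEndomorphisms.
Variables (A : comPzRingType) (gT : finGroupType).
Local Notation AG := (group_algebra A gT).

(** Every nonzero x has a nonzero translate t g x, which is a multiple of v, so
    phi is determined by its effect on the multiples of v in X. As v itself need
    not belong to X, it is the generator d of the ideal of the a with a v in X
    that makes this effect a scalar of A. *)
Lemma scalar_linear_endo (V : lmodType AG) (X : submodClosed V) (t : AG)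
    (v : V) (d : A) :
  (forall x : V, exists a : A, t *: x = ga_scalar gT a *: v) ->
  t *: v = v ->
  (forall x : V, (forall g, t *: (ga_elt A g *: x) = 0) -> x = 0) ->
  ga_scalar gT d *: v \in X ->
  (forall a : A, ga_scalar gT a *: v \in X -> exists b, a = b * d) ->
  forall phi : {linear submodule X -> submodule X},
    exists k : A, forall x, phi x = ga_scalar gT k *: x.
Proof.
move=> tV tv faithful dX dgen phi.
pose w : submodule X := Submodule dX.
have [a ta] := tV (val (phi w)).
have tw : t *: w = w.
  by apply: val_inj; rewrite linearZ /= scalerA ga_scalarC -scalerA tv.
have phiw : val (phi w) = ga_scalar gT a *: v.
  by rewrite -ta -linearZ -linearZ tw.
(* phi (d v) is a multiple of v inside X, hence a multiple of d v. *)
have [k Ek] : exists k, a = k * d by apply: dgen; rewrite -phiw; apply: valP.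
have phik b (y : submodule X) : val y = ga_scalar gT b *: v ->
    phi y = ga_scalar gT k *: y.
  move=> Ey; have [e Ee] : exists e, b = e * d.
    by apply: dgen; rewrite -Ey; apply: valP.
  have -> : y = ga_scalar gT e *: w.
    by apply: val_inj; rewrite Ey Ee /= ga_scalarM -scalerA.
  apply: val_inj; rewrite linearZ /= phiw Ek !scalerA -!ga_scalarM.
  by rewrite mulrCA mulrA.
exists k => x; apply/eqP; rewrite -subr_eq0; apply/eqP/val_inj.
rewrite [RHS]linear0; apply: faithful => g.
rewrite scalerA -linearZ; set s := t * _.
have [b Eb] := tV (ga_elt A g *: val x).
suff -> : s *: (phi x - ga_scalar gT k *: x) = 0 by rewrite linear0.
rewrite scalerBr -linearZ (phik b) ?scalerA ?ga_scalarC ?subrr //.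
by rewrite linearZ /= -scalerA.
Qed.

End ScalarEndomorphisms.

(** Serves both for R itself and for its residue ring, whose ideals are
    principal because their inverse images in R are. *)
Lemma principal_coefficients (R : comNzRingType) (A : comPzRingType)
    (gT : finGroupType) (f : {rmorphism R -> A}) :
    principal_ideal_ring R -> (forall a, exists r, f r = a) ->
  forall (V : lmodType (group_algebra A gT)) (X : submodClosed V) (w : V),
  exists2 d : A, ga_scalar gT d *: w \in X &
    forall a : A, ga_scalar gT a *: w \in X -> exists b, a = b * d.
Proof.
move=> R_pid f_surj V X w.
pose J : {pred R^o} := fun a : R => ga_scalar gT (f a) *: w \in X.
have [|d dJ] := R_pid J.
  split=> [|a x y xJ yJ]; rewrite /J unfold_in.
    by rewrite rmorph0 /ga_scalar !scale0r rpred0.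
  have -> : ga_scalar gT (f (a *: x + y)) =
            ga_scalar gT (f a) * ga_scalar gT (f x) + ga_scalar gT (f y).
    rewrite -[a *: x]/(a * x) rmorphD rmorphM -ga_scalarM.
    by rewrite /ga_scalar scalerDl.
  have xX : ga_scalar gT (f x) *: w \in X by [].
  by rewrite scalerDl -scalerA; apply: rpredD => //; apply: rpredZ.
exists (f d) => [|a]; first by apply/dJ; exists 1; rewrite mul1r.
have [r <-] := f_surj a; case/dJ=> b ->; exists (f b).
by rewrite rmorphM.
Qed.

(** * Reduction modulo l *)

Section GroupAlgebraReduction.
Variables (R : comNzRingType) (gT : finGroupType) (l : nat).
Local Notation RG := (group_algebra R gT).
Local Notation K := (residue R l).

Lemma ga_reduce_elt (g : gT) : ga_reduce l (ga_elt R g) = ga_elt K g.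
Proof. by apply: gaP => h; rewrite ga_reduceE !ga_eltE rmorph_nat. Qed.

Lemma ga_reduce_scalar (a : R) :
  ga_reduce l (ga_scalar gT a) = ga_scalar gT (to_residue l a).
Proof.
apply: gaP => h; rewrite ga_reduceE /ga_scalar !ga_coefZ rmorphM /=.
by rewrite -ga_reduceE ga_reduce1.
Qed.

Lemma to_reductionZ (V : lmodType RG) (a : RG) (x : V) :
  to_reduction l (a *: x) = ga_reduce l a *: to_reduction l x.
Proof. by rewrite [RHS]reduction_scaleE. Qed.

End GroupAlgebraReduction.

(** * Permutation matrices, unitriangular matrices and transvections *)

Section Matrices.
Variables (F : finFieldType) (n : nat).
Local Notation G := (GLgroup F n).
Local Notation I_ := 'I_n.-1.+1.
Local Notation perm_GL s := (@perm_GL F n s : G).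

Lemma GLval_inj : injective (@GLval n F).
Proof. exact: val_inj. Qed.

Lemma perm_GLM (s t : 'S_n.-1.+1) :
  perm_GL (s * t)%g = (perm_GL s * perm_GL t)%g.
Proof. by apply: GLval_inj; rewrite GL_MxE /= perm_mxM. Qed.

Lemma perm_GLMl (s : 'S_n.-1.+1) (g : G) i j :
  GLval (perm_GL s * g)%g i j = GLval g (s i) j.
Proof. by rewrite GL_MxE /= -row_permE mxE. Qed.

Lemma perm_GLMr (s : 'S_n.-1.+1) (g : G) i j :
  GLval (g * perm_GL s)%g i j = GLval g i ((s^-1)%g j).
Proof. by rewrite GL_MxE /= -{1}[s]invgK -col_permE mxE. Qed.

Lemma perm_GLV (s : 'S_n.-1.+1) : (perm_GL s)^-1%g = perm_GL s^-1%g.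
Proof.
by apply/eqP; rewrite eq_invg_mul -perm_GLM mulgV;
   apply/eqP/GLval_inj; rewrite /= perm_mx1.
Qed.

Definition unitriangular : {set G} :=
  [set g in borel F n | [forall i, GLval g i i == 1]].

Lemma unitriangularP (g : G) :
  reflect (g \in borel F n /\ forall i, GLval g i i = 1)
          (g \in unitriangular).
Proof.
rewrite [g \in unitriangular]in_set; apply: (iffP andP) => -[gB g1]; split=> //.
  by move=> i; apply/eqP/(forallP g1).
by apply/forallP => i; rewrite g1.
Qed.

Lemma unitriangular_group_set : group_set unitriangular.
Proof.
apply/group_setP; split=> [|g h /unitriangularP[gB g1] /unitriangularP[hB h1]].
  by apply/unitriangularP; split=> [|i]; rewrite ?group1 // GL_1E mxE eqxx.
apply/unitriangularP; split=> [|i]; first exact: groupM.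
rewrite GL_MxE mxE (bigD1 i) //= g1 h1 mul1r big1 ?addr0 // => k.
rewrite neq_ltn => /orP[ki|ik]; first by rewrite (borelP _ gB) ?mul0r.
by rewrite (borelP _ hB) ?mulr0.
Qed.

Canonical unitriangular_group := Group unitriangular_group_set.

(** The values of both permutations have the same sum, so none of the
    inequalities can be strict. *)
Lemma perm_leq_eq m (s t : 'S_m) : (forall i, s i <= t i)%N -> s = t.
Proof.
move=> le_st; apply/permP => i.
have := leqif_sum (fun i (_ : xpredT i) => leqif_eq (le_st i)).
pose val_nat (k : 'I_m) : nat := k.
rewrite -(reindex_inj (@perm_inj _ s) (P := xpredT) (F := val_nat)).
rewrite -(reindex_inj (@perm_inj _ t) (P := xpredT) (F := val_nat)).
case=> _; rewrite eqxx => /esym/forallP/(_ i)/eqP => E; exact: val_inj.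
Qed.

(** Since u i i = 1, the matrix s^-1 u t has the entry 1 at (s i, t i), which
    lies on or above the diagonal. *)
Lemma unitriangular_perm_cell (u : G) (s t : 'S_n.-1.+1) :
    u \in unitriangular ->
  ((perm_GL s)^-1 * (u * perm_GL t))%g \in borel F n -> s = t.
Proof.
case/unitriangularP=> _ u1 suB; apply: perm_leq_eq => i.
rewrite leqNgt; apply/negP => /(borelP _ suB)/eqP.
by rewrite perm_GLV perm_GLMl perm_GLMr !permK u1 oner_eq0.
Qed.

Definition longest_perm : 'S_n.-1.+1 := perm (@rev_ord_inj n.-1.+1).

(** Conjugation by the longest permutation makes u lower triangular. *)
Lemma unitriangular_longest (u : G) :
    u \in unitriangular ->
  ((perm_GL longest_perm)^-1 * (u * perm_GL longest_perm))%g \in borel F n ->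
  u = 1%g.
Proof.
case/unitriangularP=> uB u1 suB; apply/GLval_inj/matrixP=> i j.
rewrite GL_1E mxE; have [->|] := eqVneq i j; first by rewrite u1.
rewrite neq_ltn => /orP[ij|/(borelP _ uB)//].
have := borelP _ suB (longest_perm i) (longest_perm j).
rewrite perm_GLV perm_GLMl perm_GLMr !permK; apply.
rewrite ![longest_perm _]permE; apply: ltn_sub2l; last by rewrite ltnS.
exact: leq_ltn_trans (ltn_ord j).
Qed.

(** Conjugation by a permutation matrix permutes the positions of the
    off-diagonal entries; the hypothesis places all of them above the
    diagonal. *)
Lemma conj_perm_borel (s : 'S_n.-1.+1) (g : G) :
    (forall k l, k != l -> GLval g k l != 0 -> (s k < s l)%N) ->
  ((perm_GL s)^-1 * (g * perm_GL s))%g \in borel F n.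
Proof.
move=> off; apply/borelP => i j ji; apply/eqP/negPn/negP.
rewrite perm_GLV perm_GLMl perm_GLMr => /off.
rewrite !permKV (inj_eq perm_inj) neq_ltn ji orbT => /(_ isT).
by rewrite ltnNge ltnW.
Qed.

Lemma transvection_unitmx (t : F) (i j : I_) : i != j ->
  1%:M + t *: delta_mx i j \in unitmx.
Proof.
move=> ij; have [] // := @mulmx1_unit _ _ (1%:M + t *: delta_mx i j)
  (1%:M - t *: delta_mx i j) _.
rewrite mulmxBr mulmx1 mulmxDl mul1mx -scalemxAl -scalemxAr.
by rewrite mul_delta_mx_0 1?eq_sym // !scaler0 addr0 addrK.
Qed.

Definition transvection (t : F) (i j : I_) (ij : i != j) : G :=
  FinRing.Unit (transvection_unitmx t ij).

Lemma transvectionE t i j (ij : i != j) k l :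
  GLval (transvection t ij) k l = (k == l)%:R + t *+ ((k == i) && (l == j)).
Proof. by rewrite /= !mxE mulr_natr. Qed.

Lemma transvectionMr (g : G) t i j (ij : i != j) k l :
  GLval (g * transvection t ij)%g k l =
    GLval g k l + t * GLval g k i *+ (l == j).
Proof.
rewrite GL_MxE mulmxDr mulmx1 mxE; congr (_ + _).
rewrite -scalemxAr mxE mxE (bigD1 i) //= big1 ?addr0 => [|m /negPf mi].
  by rewrite mxE eqxx /= mulr_natr mulrnAr.
by rewrite mxE mi mulr0.
Qed.

Lemma transvectionV t i j (ij : i != j) :
  ((transvection t ij)^-1 = transvection (- t) ij)%g.
Proof.
apply/eqP; rewrite eq_invg_mul; apply/eqP/GLval_inj/matrixP => k l.
rewrite transvectionMr !transvectionE GL_1E mxE.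
rewrite (negPf ij) andbF addr0.
case: (k == i); case: (l == j);
  rewrite /= ?mulr0n ?mulr1n ?mulr0 ?mul0rn ?addr0 //.
by rewrite mulr1 addrK.
Qed.

Lemma diag_unitmx (d : 'rV[F]_n.-1.+1) :
  (forall i, d 0 i != 0) -> diag_mx d \in unitmx.
Proof. by move=> d0; rewrite unitmxE det_diag unitfE; apply/prodf_neq0. Qed.

Lemma borel_diag_neq0 (b : G) i : b \in borel F n -> GLval b i i != 0.
Proof.
move=> bB; have := GL_det b.
rewrite -det_tr det_trig; first by move/prodf_neq0/(_ i isT); rewrite mxE.
by apply/is_trig_mxP => k l kl; rewrite mxE (borelP _ bB).
Qed.

End Matrices.

(** * Relations satisfied by the Steinberg generator *)

Section Generator.
Variables (F : finFieldType) (n : nat) (R : idomainType).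
Local Notation G := (GLgroup F n).
Local Notation RG := (group_algebra R G).
Local Notation elt := (ga_elt R).
Local Notation perm_GL s := (@perm_GL F n s : G).
Local Notation eps := (steinberg_gen F n R).

(** In the permutation module on G / B, this is the flag spanned successively by
    the standard basis vectors, the vector e_i being the one at position s i. *)
Definition weyl_coset (s : 'S_n.-1.+1) : RG :=
  elt (perm_GL s) * ga_hat R (borel F n).

Lemma elt_weyl_coset (g : G) (s : 'S_n.-1.+1) :
    (forall k l, k != l -> GLval g k l != 0 -> (s k < s l)%N) ->
  elt g * weyl_coset s = weyl_coset s.
Proof.
move=> off; rewrite /weyl_coset mulrA -ga_eltM; apply/esym/ga_elt_coset.
exact: conj_perm_borel.
Qed.

Lemma steinberg_genE : eps = \sum_(s : 'S_n.-1.+1) (-1) ^+ s *: weyl_coset s.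
Proof. by []. Qed.

Lemma perm_steinberg_gen (s : 'S_n.-1.+1) :
  elt (perm_GL s) * eps = (-1) ^+ s *: eps.
Proof.
rewrite steinberg_genE mulr_sumr scaler_sumr (reindex_inj (mulgI s^-1%g)) /=.
apply: eq_bigr => r _; rewrite -ga_scaleAr /weyl_coset mulrA -ga_eltM.
by rewrite -perm_GLM mulKVg scalerA odd_permM odd_permV signr_addb.
Qed.

Lemma diag_steinberg_gen (g : G) : (forall k l, k != l -> GLval g k l = 0) ->
  elt g * eps = eps.
Proof.
move=> g0; rewrite steinberg_genE mulr_sumr; apply: eq_bigr => s _.
by rewrite -ga_scaleAr elt_weyl_coset // => k l /g0->; rewrite eqxx.
Qed.

(** The flags of the standard frame are paired by exchanging the basis vectors
    i and j; in each pair s is the flag in which i comes before j. *)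
Lemma steinberg_gen_split (i j : 'I_n.-1.+1) : i != j ->
  eps = \sum_(s : 'S_n.-1.+1 | (s i < s j)%N)
          (-1) ^+ s *: (weyl_coset s - weyl_coset (tperm i j * s)%g).
Proof.
move=> ij; rewrite steinberg_genE (bigID (fun s : 'S__ => s i < s j)%N) /=.
rewrite [X in _ + X](reindex_inj (mulgI (tperm i j))) /=.
under [RHS]eq_bigr do rewrite scalerBr.
rewrite big_split /=; congr (_ + _); apply: eq_big => [s|s _].
  by rewrite !permM tpermL tpermR -leqNgt leq_eqVlt (inj_eq val_inj)
     (inj_eq perm_inj) (negPf ij).
by rewrite odd_permM odd_tperm ij /= signrN scaleNr.
Qed.

Lemma mulrB_telescope (A : pzRingType) (x y a b : A) :
  x * a = a -> y * b = b -> x * b = y * a ->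
  a - b = x * (a - b) + y * (a - b).
Proof. by move=> xa yb xb; rewrite !mulrBr xa yb xb addrA subrK. Qed.

Lemma invMg_conj (gT : finGroupType) (a b x y : gT) :
  ((x * (a * b))^-1 * (y * b) = b^-1 * (a^-1 * (x^-1 * y) * b))%g.
Proof. by rewrite !invMg !mulgA. Qed.

(** With z = e_j + t e_i, the two terms on the right are the alternating sums of
    the frames (e_i, z) and (z, e_j), the other basis vectors being kept: in the
    plane of e_i and e_j this is the identity a - b = (a - z) + (z - b) between
    lines. On a pair of flags s and r, where r is s with e_i and e_j exchanged,
    the first transvection fixes s, the second fixes r, and the two map r and s
    respectively to the same flag, the one through z. *)
Lemma steinberg_gen_three_term (t : F) (i j : 'I_n.-1.+1)
    (ij : i != j) (ji : j != i) :
    t != 0 ->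
  eps = elt (transvection t ij) * eps + elt (transvection t^-1 ji) * eps.
Proof.
move=> t0; rewrite !(steinberg_gen_split ij) !mulr_sumr -big_split /=.
apply: eq_bigr => s sij; rewrite -!ga_scaleAr -scalerDr; congr (_ *: _).
set r := (tperm i j * s)%g.
have Es : elt (transvection t ij) * weyl_coset s = weyl_coset s.
  apply: elt_weyl_coset => k l /negPf kl; rewrite transvectionE kl add0r.
  by case: andP => [[/eqP-> /eqP->]|]; rewrite ?eqxx.
have Er : elt (transvection t^-1 ji) * weyl_coset r = weyl_coset r.
  apply: elt_weyl_coset => k l /negPf kl; rewrite transvectionE kl add0r.
  by case: andP => [[/eqP-> /eqP->]|]; rewrite ?eqxx // !permM tpermL tpermR.
have Ers : elt (transvection t ij) * weyl_coset r =
           elt (transvection t^-1 ji) * weyl_coset s.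
  rewrite /weyl_coset !mulrA -!ga_eltM; apply: ga_elt_coset.
  set x := transvection t ij; set y := transvection t^-1 ji.
  have -> : ((x * perm_GL r)^-1 * (y * perm_GL s) = (perm_GL s)^-1 *
      ((perm_GL (tperm i j))^-1 * (x^-1 * y) * perm_GL s))%g.
    by rewrite /r perm_GLM invMg_conj.
  apply: conj_perm_borel => k l kl.
  rewrite perm_GLV tpermV perm_GLMl transvectionV transvectionMr !transvectionE.
  case: tpermP => [ki|kj|/eqP/negPf ki /eqP/negPf kj].
  - have li : (l == i) = false by rewrite eq_sym -ki (negPf kl).
    rewrite (negPf ji) li /= ?mulr0n ?addr0 ki; case: (eqVneq j l) => [<- //|_].
    by rewrite mulr0n eqxx.
  - have lj : (l == j) = false by rewrite eq_sym -kj (negPf kl).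
    rewrite lj !eqxx (negPf ij) /= mulr0n mulr1n addr0 add0r mulrN mulVf //.
    by rewrite (eq_sym l); case: (i == l); rewrite ?mulr0n ?addr0 ?subrr eqxx.
  - by rewrite ki (negPf kl) kj /= ?mulr0n !add0r mulr0 mul0rn eqxx.
exact: mulrB_telescope.
Qed.

End Generator.

(** * The unitriangular translates of the generator span the lattice *)

Section Spanning.
Variables (F : finFieldType) (n : nat) (R : idomainType).
Local Notation G := (GLgroup F n).
Local Notation RG := (group_algebra R G).
Local Notation elt := (ga_elt R).
Local Notation perm_GL s := (@perm_GL F n s : G).
Local Notation eps := (steinberg_gen F n R).
Local Notation U := (unitriangular F n).

Definition unitriangular_span (x : RG) : Prop :=
  exists a : G -> R, x = \sum_(u in U) a u *: (elt u * eps).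

Lemma unitriangular_spanD x y :
  unitriangular_span x -> unitriangular_span y -> unitriangular_span (x + y).
Proof.
move=> [a ->] [b ->]; exists (fun u => a u + b u).
by rewrite -big_split /=; apply: eq_bigr => u _; rewrite scalerDl.
Qed.

Lemma unitriangular_spanZ c x :
  unitriangular_span x -> unitriangular_span (c *: x).
Proof.
move=> [a ->]; exists (fun u => c * a u).
by rewrite scaler_sumr; apply: eq_bigr => u _; rewrite scalerA.
Qed.

(** A triangular matrix is unitriangular times diagonal, and diagonal matrices
    fix eps. *)
Lemma unitriangular_span_borel (b : G) :
  b \in borel F n -> unitriangular_span (elt b * eps).
Proof.
move=> bB; pose d := \row_i GLval b i i.
have d0 i : d 0 i != 0 by rewrite mxE borel_diag_neq0.
pose t : G := FinRing.Unit (diag_unitmx d0).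
have tE k l : GLval t k l = GLval b k k *+ (k == l) by rewrite /= !mxE.
have tB : t \in borel F n.
  by apply/borelP => i j ji; rewrite tE -val_eqE gtn_eqF ?mulr0n.
have uU : (b * t^-1)%g \in U.
  have uB : (b * t^-1)%g \in borel F n by rewrite groupM ?groupV.
  apply/unitriangularP; split=> // i.
  have /(congr1 (fun g : G => GLval g i i)) := mulgKV t b.
  rewrite GL_MxE mxE (bigD1 i) //= big1 => [|j /negPf ji]; last first.
    by rewrite -[diag_mx _ _ _]/(GLval t j i) tE ji mulr0n mulr0.
  rewrite addr0 -[diag_mx _ _ _]/(GLval t i i) tE eqxx mulr1n.
  move/(congr1 (fun z => z / GLval b i i)).
  by rewrite mulfK ?divff ?borel_diag_neq0.
exists (fun u => (u == (b * t^-1)%g)%:R).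
rewrite (bigD1 _ uU) /= eqxx scale1r big1 ?addr0 => [|u /andP[_ /negPf->]].
  rewrite -[in LHS](mulgKV t b) [in LHS]ga_eltM -[LHS]mulrA.
  rewrite diag_steinberg_gen // => k l.
  by rewrite tE => /negPf->.
by rewrite scale0r.
Qed.

Definition triangular_from (m : nat) (g : G) : Prop :=
  forall i j : 'I_n.-1.+1, (m <= i)%N -> (j < i)%N -> GLval g i j = 0.

Lemma unitriangular_span_swap (g : G) (i j : 'I_n.-1.+1) :
  unitriangular_span (elt (g * perm_GL (tperm i j))%g * eps) ->
  unitriangular_span (elt g * eps).
Proof.
rewrite ga_eltM -mulrA perm_steinberg_gen -ga_scaleAr.
move=> /(unitriangular_spanZ ((-1) ^+ tperm i j)).
by rewrite scalerA -signr_addb addbb scale1r.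
Qed.

(** Elimination of the entries of row k to the left of the diagonal by column
    operations, the rows below k being already cleared. Let i < k be the column
    of a nonzero entry. If the diagonal entry is 0, exchanging columns i and k
    removes one such entry. Otherwise the three-term relation replaces g by two
    matrices: in one the diagonal entry has been cleared by column i, in the
    other the entry in column i has been cleared by the diagonal one. *)
Lemma unitriangular_span_row (k : 'I_n.-1.+1) :
    (forall g, triangular_from k g -> unitriangular_span (elt g * eps)) ->
  forall g, triangular_from k.+1 g -> unitriangular_span (elt g * eps).
Proof.
move=> IHk g.
pose S (h : G) := [set j : 'I_n.-1.+1 | (j < k)%N & GLval h k j != 0].
(* The diagonal entry counts for one and the entries to its left for two, so
   that the measure decreases in the exchange as well. *)
have [N] := ubnP (2 * #|S g| + (GLval g k k != 0)%R)%N; elim: N g => // N IHN g.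
rewrite ltnS => leN gk; have [S0|[i iS]] := set_0Vmem (S g).
  apply: IHk => i j; rewrite leq_eqVlt.
  case/orP=> [/eqP/val_inj<- jk|]; last exact: gk.
  apply/eqP/negPn/negP => gkj; have : j \in S g by rewrite inE jk gkj.
  by rewrite S0 inE.
have /[!inE] /andP[ik gki] := iS.
have nik : i != k by rewrite -val_eqE ltn_eqF.
have nki : k != i by rewrite eq_sym.
have Sdel h : S h = S g :\ i -> (2 * #|S h| + (GLval h k k != 0)%R < N)%N.
  move=> Sh; have := leN; rewrite (cardsD1 i (S g)) iS -Sh mulnDr /= => {}leN.
  by apply: leq_trans leN; rewrite -addnA ltnS; case: (_ != 0); lia.
have [gkk|gkk] := eqVneq (GLval g k k) 0.
  apply/(unitriangular_span_swap (i := i) (j := k))/IHN.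
    apply: Sdel; apply/setP => j; rewrite !inE perm_GLMr tpermV.
    by case: tpermP => [->|->|/eqP->]; rewrite ?ltnn ?eqxx ?gkk ?eqxx ?andbF.
  move=> j l kj lj; rewrite perm_GLMr tpermV; apply: gk => //.
  by case: tpermP => // _; apply: leq_trans kj => //; rewrite ltnS ltnW.
pose t := - (GLval g k k / GLval g k i).
have t0 : t != 0 by rewrite oppr_eq0 mulf_neq0 ?invr_eq0.
rewrite (steinberg_gen_three_term R nik nki t0) mulrDr 2!mulrA -2!ga_eltM.
apply: unitriangular_spanD; apply: IHN.
- have -> : S (g * transvection t nik)%g = S g.
    apply/setP => j; rewrite !inE transvectionMr.
    have [->|jk] := eqVneq j k; first by rewrite ltnn.
    by rewrite mulr0n addr0.
  rewrite transvectionMr eqxx mulr1n mulNr divfK // subrr eqxx addn0.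
  by move: leN; rewrite gkk addn1.
- move=> j l kj lj.
  rewrite transvectionMr gk // (gk j i) ?mulr0 ?mul0rn ?addr0 //.
  exact: ltn_trans ik _.
- apply: Sdel; apply/setP => j; rewrite !inE transvectionMr.
  have [->|ji] := eqVneq j i; last by rewrite mulr0n addr0.
  by rewrite /t invrN invf_div mulNr divfK // mulr1n subrr eqxx andbF.
- move=> j l kj lj.
  by rewrite transvectionMr gk // (gk j k) ?mulr0 ?mul0rn ?addr0.
Qed.

Lemma unitriangular_span_elt (g : G) : unitriangular_span (elt g * eps).
Proof.
suff H m : (m <= n.-1.+1)%N -> forall h : G, triangular_from m h ->
    unitriangular_span (elt h * eps).
  by apply: (H n.-1.+1) => // i j; rewrite leqNgt ltn_ord.
elim: m => [|m IHm] lemn h hm.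
  by apply/unitriangular_span_borel/borelP => i j; apply: hm.
by apply: (@unitriangular_span_row (Ordinal lemn)) => //=; apply/IHm/ltnW.
Qed.

Lemma steinberg_unitriangular_span (x : steinberg F n R) :
  unitriangular_span (val x).
Proof.
have /steinberg_predP[a ->] := valP x.
rewrite [a]ga_sum_elt mulr_suml; elim/big_ind: _ => [|y z|g _].
- exists (fun=> 0); rewrite big1 // => u _; exact: scale0r.
- exact: unitriangular_spanD.
- by rewrite -ga_scaleAl; apply/unitriangular_spanZ/unitriangular_span_elt.
Qed.

End Spanning.

(** * A coordinate on the Steinberg lattice and the projection it defines *)

Lemma submodule_valZ (A : pzRingType) (V : lmodType A) (S : submodClosed V)
  (a : A) (x : submodule S) : val (a *: x) = a *: val x.
Proof. by []. Qed.

Section SteinbergCoordinate.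
Variables (F : finFieldType) (n : nat) (R : idomainType).
Local Notation G := (GLgroup F n).
Local Notation RG := (group_algebra R G).
Local Notation elt := (ga_elt R).
Local Notation perm_GL s := (@perm_GL F n s : G).
Local Notation eps := (steinberg_gen F n R).
Local Notation U := (unitriangular F n).
Local Notation St := (steinberg F n R).
Local Notation w0 := (longest_perm n).

(** Among the cosets r B only s B can meet U s, by unitriangular_perm_cell. *)
Lemma ga_coef_steinberg_gen (u : G) (s : 'S_n.-1.+1) : u \in U ->
  ga_coef eps (u * perm_GL s)%g =
    (-1) ^+ s * ((perm_GL s)^-1 * (u * perm_GL s) \in borel F n)%g%:R.
Proof.
move=> uU; rewrite steinberg_genE ga_coef_sum (bigD1 s) //= big1 ?addr0.
  by rewrite ga_coefZ /weyl_coset ga_coef_eltM ga_coef_hat.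
move=> r rs; rewrite ga_coefZ /weyl_coset ga_coef_eltM ga_coef_hat.
case: (boolP (_ \in _)) => [suB|_]; last exact: mulr0.
by rewrite (unitriangular_perm_cell uU suB) eqxx in rs.
Qed.

Lemma steinberg_genP :
  (eps : RG^o) \in steinberg_pred (F := F) (n := n) (R := R).
Proof. by apply/steinberg_predP; exists 1; rewrite mul1r. Qed.

Definition steinberg_elt : St := Submodule steinberg_genP.

(** The coordinate at eps with respect to the family of the u eps, for u in U;
    see steinberg_coord_unitriangular. *)
Definition steinberg_coord (x : St) : R :=
  (-1) ^+ w0 * ga_coef (val x) (perm_GL w0).

Lemma steinberg_valZ (a : RG) (x : St) : (val (a *: x) : RG) = a * (val x : RG).
Proof. exact: (@submodule_valZ RG (RG^o) _ a x). Qed.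

Lemma steinberg_val_scalar (a : R) (x : St) :
  (val (ga_scalar G a *: x) : RG) = a *: (val x : RG).
Proof. by rewrite steinberg_valZ ga_scalarE. Qed.

Lemma steinberg_coord_sum (I : Type) (r : seq I) (P : pred I) (f : I -> St) :
  steinberg_coord (\sum_(i <- r | P i) f i)
    = \sum_(i <- r | P i) steinberg_coord (f i).
Proof. by rewrite /steinberg_coord raddf_sum ga_coef_sum mulr_sumr. Qed.

Lemma steinberg_coord0 : steinberg_coord 0 = 0.
Proof.
by have := @steinberg_coord_sum nat [::] xpredT (fun=> 0); rewrite !big_nil.
Qed.

Lemma steinberg_coordZ (a : R) (x : St) :
  steinberg_coord (ga_scalar G a *: x) = a * steinberg_coord x.
Proof. by rewrite /steinberg_coord steinberg_val_scalar ga_coefZ mulrCA. Qed.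

Lemma steinberg_coordMn (x : St) m :
  steinberg_coord (x *+ m) = m%:R * steinberg_coord x.
Proof.
rewrite -steinberg_coordZ; congr steinberg_coord.
by rewrite /ga_scalar scaler_nat -scalerMnl scale1r.
Qed.

Lemma steinberg_coord_unitriangular (u : G) : u \in U ->
  steinberg_coord (elt u *: steinberg_elt) = (u == 1%g)%:R.
Proof.
move=> uU; have uV := groupVr uU.
rewrite /steinberg_coord steinberg_valZ ga_coef_eltM.
rewrite (ga_coef_steinberg_gen _ uV).
rewrite mulrA -signr_addb addbb mul1r; congr (nat_of_bool _)%:R.
apply/idP/eqP => [uB|->].
  by rewrite -[u]invgK (unitriangular_longest uV uB) invg1.
by rewrite invg1 mul1g mulVg group1.
Qed.

(** The coordinate of x at u eps is that of u^-1 x at eps. The formula expresses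
    x by values of the coordinate on translates of x, hence divisibility of all
    of these by l makes x a multiple of l in I. *)
Lemma steinberg_expansion (x : St) :
  x = \sum_(u in U)
        ga_scalar G (steinberg_coord (elt u^-1%g *: x)) *:
          (elt u *: steinberg_elt).
Proof.
have [a Ea] := steinberg_unitriangular_span x.
have Ex : x = \sum_(u in U) ga_scalar G (a u) *: (elt u *: steinberg_elt).
  apply: val_inj; rewrite Ea raddf_sum; apply: eq_bigr => u _.
  exact/esym/steinberg_val_scalar.
rewrite {1}Ex; apply: eq_bigr => u uU; congr (ga_scalar _ _ *: _).
rewrite {1}Ex scaler_sumr steinberg_coord_sum (bigD1 u) //= big1 ?addr0 => [|r].
  rewrite scalerA ga_scalarC -scalerA steinberg_coordZ scalerA -ga_eltM mulVg.
  by rewrite steinberg_coord_unitriangular ?group1 // eqxx mulr1.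
move=> /andP[rU ru].
rewrite scalerA ga_scalarC -scalerA steinberg_coordZ scalerA -ga_eltM.
rewrite (steinberg_coord_unitriangular (groupM (groupVr uU) rU)).
by rewrite -eq_mulVg1 eq_sym (negPf ru) mulr0.
Qed.

(** A U-fixed vector; it spans the U-fixed vectors of I. *)
Definition steinberg_spherical : St := ga_hat R U *: steinberg_elt.

(** All u eps have the same image v under U^ and the same coefficient 1 at the
    identity of G. *)
Lemma hat_unitriangular_steinberg (x : St) :
  ga_hat R U *: x =
    ga_scalar G (ga_coef (val x) 1%g) *: steinberg_spherical.
Proof.
have [a Ea] := steinberg_unitriangular_span x.
have -> : ga_coef (val x) 1%g = \sum_(u in U) a u.
  rewrite Ea ga_coef_sum; apply: eq_bigr => u uU; rewrite ga_coefZ ga_coef_eltM.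
  have -> : (u^-1 * 1 = u^-1 * perm_GL 1)%g.
    by congr (_ * _)%g; apply: GLval_inj; rewrite /= perm_mx1.
  rewrite (ga_coef_steinberg_gen _ (groupVr uU)) odd_perm1 mul1r.
  have -> : perm_GL 1%g = 1%g by apply: GLval_inj; rewrite /= perm_mx1.
  rewrite invg1 mul1g mulg1.
  by have /unitriangularP[-> _] := groupVr uU; rewrite mulr1.
apply: val_inj; rewrite [RHS]steinberg_val_scalar [LHS]steinberg_valZ Ea.
rewrite mulr_sumr scaler_suml.
apply: eq_bigr => u uU; rewrite -ga_scaleAr mulrA (ga_hat_elt R uU).
by rewrite steinberg_valZ.
Qed.

(** Translation by w0^-1 moves the coefficient at w0 to the identity, where U^
    reads it off. *)
Definition steinberg_projector : RG :=
  (-1) ^+ w0 *: (ga_hat R U * elt (perm_GL w0)^-1%g).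

Lemma steinberg_projectorE (x : St) :
  steinberg_projector *: x =
    ga_scalar G (steinberg_coord x) *: steinberg_spherical.
Proof.
rewrite /steinberg_projector -ga_scalarE -!scalerA hat_unitriangular_steinberg.
by rewrite scalerA -ga_scalarM steinberg_valZ ga_coef_eltM invgK mulg1.
Qed.

Lemma steinberg_coord_spherical : steinberg_coord steinberg_spherical = 1.
Proof.
rewrite /steinberg_spherical /ga_hat scaler_suml steinberg_coord_sum.
rewrite (bigD1 1%g) /=; last exact: group1.
rewrite (steinberg_coord_unitriangular (group1 [the {group _} of U])) eqxx.
rewrite big1 ?addr0 // => u /andP[uU /negPf u1].
by rewrite steinberg_coord_unitriangular // u1.
Qed.

Lemma steinberg_projector_spherical :
  steinberg_projector *: steinberg_spherical = steinberg_spherical.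
Proof.
rewrite steinberg_projectorE steinberg_coord_spherical.
by rewrite /ga_scalar !scale1r.
Qed.

End SteinbergCoordinate.

(** * No submodule lies in the kernel of the projection *)

Section Faithfulness.
Variables (F : finFieldType) (n : nat) (R : idomainType) (l : nat).
Local Notation G := (GLgroup F n).
Local Notation RG := (group_algebra R G).
Local Notation K := (residue R l).
Local Notation St := (steinberg F n R).
Local Notation t := (steinberg_projector F n R).
Local Notation v := (steinberg_spherical F n R).
Local Notation coord := (@steinberg_coord F n R).

Lemma steinberg_coord_projector (x : St) : coord x = coord (t *: x).
Proof.
rewrite steinberg_projectorE steinberg_coordZ.
by rewrite steinberg_coord_spherical mulr1.
Qed.

Lemma steinberg_projector_faithful (x : St) :
  (forall g : G, t *: (ga_elt R g *: x) = 0) -> x = 0.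
Proof.
move=> tx0; rewrite (steinberg_expansion x); apply: big1 => u _.
have -> : coord (ga_elt R u^-1%g *: x) = 0.
  by rewrite steinberg_coord_projector tx0 steinberg_coord0.
by rewrite /ga_scalar !scale0r.
Qed.

Lemma steinberg_reduction_projectorE (x : St) :
  ga_reduce l t *: to_reduction l x =
    ga_scalar G (to_residue l (coord x)) *: to_reduction l v.
Proof.
by rewrite -to_reductionZ steinberg_projectorE to_reductionZ ga_reduce_scalar.
Qed.

(** From t g y = 0 the coordinate of g x, for a representative x of y, is
    divisible by l. *)
Lemma steinberg_reduction_faithful (y : reduction l St) :
  (forall g : G, ga_reduce l t *: (ga_elt K g *: y) = 0) -> y = 0.
Proof.
rewrite -(of_reductionK y); set x := of_reduction y => ty0.
have xl u : to_residue l (coord (ga_elt R u *: x)) = 0.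
  have: to_reduction l (t *: (ga_elt R u *: x)) = to_reduction l (0 : St).
    by rewrite raddf0 2!to_reductionZ ga_reduce_elt; apply: ty0.
  case/to_reduction_eq=> z; rewrite subr0 => /(congr1 coord).
  rewrite -steinberg_coord_projector steinberg_coordMn => E.
  rewrite -(rmorph0 (to_residue l)); apply/to_residue_eq.
  by rewrite subr0; exists (coord z).
rewrite (steinberg_expansion x) raddf_sum; apply: big1 => u _.
by rewrite /= to_reductionZ ga_reduce_scalar xl /ga_scalar !scale0r.
Qed.

End Faithfulness.

(** * Scalar endomorphisms *)

Theorem theorem5p3
  (n : nat) (n_ge2 : (2 <= n)%N)
  (F : finFieldType) (p : nat) (char_F : p \in [pchar F])
  (l : nat) (l_prime : prime l) (l_neq_p : l <> p)
  (R : idomainType)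
  (R_pid : principal_ideal_ring R)
  (R_local : local_with_maximal_ideal (multiples R l))
  (R_char0 : [pchar R] =i pred0)
  (R_root : exists z : R, p.-primitive_root z)
  (c : nat) :
  (forall phi : {linear steinberg_term F n R l c -> steinberg_term F n R l c},
     exists r : R, forall x, phi x = ga_scalar {'GL_n[F]} r *: x) /\
  (forall phi : {linear steinberg_mod_term F n R l c
                 -> steinberg_mod_term F n R l c},
     exists k : residue R l, forall v, phi v = ga_scalar {'GL_n[F]} k *: v).
Proof.
split.
- have [|d dX dgen] := @principal_coefficients R R _ idfun R_pid _
    (steinberg F n R) (steinberg_term_pred l c) (steinberg_spherical F n R).
    by move=> a; exists a.
  apply: (@scalar_linear_endo R _ (steinberg F n R) _
    (steinberg_projector F n R) (steinberg_spherical F n R) d) => //.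
  + by move=> x; exists (steinberg_coord x); apply: steinberg_projectorE.
  + exact: steinberg_projector_spherical.
  + exact: steinberg_projector_faithful.
- have [|d dX dgen] := @principal_coefficients R (residue R l) _
    (to_residue l) R_pid _ (steinberg_mod F n R l)
    (steinberg_mod_term_pred (F := F) (n := n) (R := R) (l := l) c)
    (to_reduction l (steinberg_spherical F n R)).
    by move=> a; exists (of_residue a); apply: of_residueK.
  apply: (@scalar_linear_endo (residue R l) _ (steinberg_mod F n R l) _
    (ga_reduce l (steinberg_projector F n R))
    (to_reduction l (steinberg_spherical F n R)) d) => //.
  + move=> y; exists (to_residue l (steinberg_coord (of_reduction y))).
    by rewrite -steinberg_reduction_projectorE of_reductionK.
  + by rewrite -to_reductionZ steinberg_projector_spherical.
  + exact: steinberg_reduction_faithful.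
Qed.
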